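(* Let $\mathcal{I}=\left((\mathrm{E}_\alpha)_{\alpha\in I},(p_{\beta,\alpha})_{\beta\succcurlyeq\alpha}\right)$ be an inverse system in $\mathbf{VL}$. Define $$\mathrm{E}=\left\{u\in\prod_{\alpha\in I}\mathrm{E}_\alpha : \pi_\alpha(u)=p_{\beta,\alpha}(\pi_\beta(u)) \text{ for all } \alpha\preccurlyeq\beta \text{ in } I\right\},$$ and for every $\alpha\in I$ let $p_\alpha=\pi_\alpha|_{\mathrm{E}}$. The following statements are true. (i) $\mathrm{E}$ is a vector sublattice of $\prod\mathrm{E}_\alpha$. (ii) The pair $\mathcal{S}=\left(\mathrm{E},(p_\alpha)_{\alpha\in I}\right)$ is the inverse limit of $\mathcal{I}$ in $\mathbf{VL}$.
   Context: All vector lattices are real. $\mathbf{VL}$ is the category of vector lattices and (linear) lattice homomorphisms. $\prod\mathrm{E}_\alpha$ is a vector lattice with coordinatewise operations and order, and $\pi_\beta$ is the coordinate projection onto $\mathrm{E}_\beta$. An inverse system in $\mathbf{VL}$ consists of a directed set $I$, vector lattices $\mathrm{E}_\alpha$ and lattice homomorphisms $p_{\beta,\alpha}:\mathrm{E}_\beta\to\mathrm{E}_\alpha$ ($\beta\succcurlyeq\alpha$) with $p_{\beta,\alpha}\circ p_{\gamma,\beta}=p_{\gamma,\alpha}$ for $\alpha\preccurlyeq\beta\preccurlyeq\gamma$. A compatible system is a vector lattice $\mathrm{E}$ with lattice homomorphisms $p_\alpha:\mathrm{E}\to\mathrm{E}_\alpha$ satisfying $p_{\beta,\alpha}\circ p_\beta=p_\alpha$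 for $\alpha\preccurlyeq\beta$. The inverse limit in $\mathbf{VL}$ is a compatible system $(\mathrm{E},(p_\alpha))$ such that for every compatible system $(\tilde{\mathrm{E}},(\tilde p_\alpha))$ there is a unique lattice homomorphism $s:\tilde{\mathrm{E}}\to\mathrm{E}$ with $p_\alpha\circ s=\tilde p_\alpha$ for all $\alpha\in I$. *)

(* Defs.v *)
From HB Require Import structures.
From mathcomp Require Import all_boot all_order all_algebra.
From mathcomp Require Import mathcomp_extra boolp reals.

Set Implicit Arguments.
Unset Strict Implicit.
Unset Printing Implicit Defensive.

Import Order.TTheory GRing.Theory Num.Theory.
Local Open Scope ring_scope.

(* Real vector lattices (Riesz spaces).  The order is that of an ordered      *)
(* Z-module.  The meet and join are fields of their own, with the axioms of   *)
(* [Order.POrder_MeetJoin_isLattice]: Hierarchy-Builder rejects a structure   *)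
(* joining [GRing.Zmodule] and [Order.Lattice] that is declared after         *)
(* [Num.RealDomain].                                                          *)
HB.mixin Record isVectorLattice (R : realType) V
    of GRing.Lmodule R V & Num.POrderedZmodule V := {
  vl_leD2r : forall z x y : V, x <= y -> x + z <= y + z;
  vl_scale_ge0 : forall (a : R) (x : V), 0 <= a -> 0 <= x -> 0 <= a *: x;
  vl_meet : V -> V -> V;
  vl_join : V -> V -> V;
  vl_lexI : forall x y z : V, (x <= vl_meet y z) = (x <= y) && (x <= z);
  vl_leUx : forall x y z : V, (vl_join x y <= z) = (x <= z) && (y <= z)
}.

#[short(type="vectorLatticeType")]
HB.structure Definition VectorLattice (R : realType) :=
  { V of GRing.Lmodule R V & Num.POrderedZmodule V & isVectorLattice R V }.

Definition lattice_hom (R : realType) (V W : vectorLatticeType R)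
    (f : V -> W) : Prop :=
  [/\ linear f, {morph f : x y / vl_meet x y} & {morph f : x y / vl_join x y}].

Definition vector_sublattice (R : realType) (V : vectorLatticeType R)
    (S : {pred V}) : Prop :=
  [/\ submod_closed S, {in S &, forall x y, vl_meet x y \in S}
     & {in S &, forall x y, vl_join x y \in S}].

(* A vector sublattice as a vector lattice in its own right, with the         *)
(* structure induced by the ambient one; the closure proof [SV] occurs in the *)
(* type only so that instances can be attached to it.                         *)
Section SubVectorLattice.
Variables (R : realType) (V : vectorLatticeType R) (S : {pred V}).

Definition sub_vlattice (SV : vector_sublattice S) : Type := {u : V | u \in S}.

Variable SV : vector_sublattice S.
Local Notation U := (sub_vlattice SV).

HB.instance Definition _ := [isSub of U for @sval V (fun u => u \in S)].
HB.instance Definition _ := [Choice of U by <:].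

Let Ssubmod : submod_closed S. Proof. by case: SV. Qed.
HB.instance Definition _ :=
  GRing.SubChoice_isSubLmodule.Build R V (fun u => u \in S) U Ssubmod.
HB.instance Definition _ :=
  Order.SubChoice_isSubPOrder.Build
    ring_display V (fun u => u \in S) ring_display U.

Let Smeet (x y : U) : vl_meet (\val x) (\val y) \in S.
Proof. by case: SV => _ + _; apply; exact: valP. Qed.
Let Sjoin (x y : U) : vl_join (\val x) (\val y) \in S.
Proof. by case: SV => _ _; apply; exact: valP. Qed.
Let meet (x y : U) : U := exist (fun u => u \in S) _ (Smeet x y).
Let join (x y : U) : U := exist (fun u => u \in S) _ (Sjoin x y).

Let leD2r (z x y : U) : x <= y -> x + z <= y + z.
Proof. by rewrite -!Order.le_val !raddfD; exact: vl_leD2r. Qed.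
Let scale_ge0 (a : R) (x : U) : 0 <= a -> 0 <= x -> 0 <= a *: x.
Proof. by rewrite -!Order.le_val linearZ raddf0; exact: vl_scale_ge0. Qed.
Let lexI (x y z : U) : (x <= meet y z) = (x <= y) && (x <= z).
Proof. by rewrite -!Order.le_val vl_lexI. Qed.
Let leUx (x y z : U) : (join x y <= z) = (x <= z) && (y <= z).
Proof. by rewrite -!Order.le_val vl_leUx. Qed.

HB.instance Definition _ := isVectorLattice.Build R U leD2r scale_ge0 lexI leUx.
End SubVectorLattice.

(* The product of a family of vector lattices.  This is an alias: the library *)
(* puts the pointwise order on (non-dependent) functions in another display.  *)
Definition vl_prod (R : realType) (I : Type) (E : I -> vectorLatticeType R) :
  Type := forall i, E i.

Section ProductVectorLattice.
Variables (R : realType) (I : Type) (E : I -> vectorLatticeType R).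
Local Notation P := (vl_prod E).
Implicit Types (u v w : P) (a b : R).

HB.instance Definition _ := gen_eqMixin P.
HB.instance Definition _ := gen_choiceMixin P.

Let add u v : P := fun i => u i + v i.
Let opp u : P := fun i => - u i.
Let scale a u : P := fun i => a *: u i.
Let meet u v : P := fun i => vl_meet (u i) (v i).
Let join u v : P := fun i => vl_join (u i) (v i).
Let le u v : bool := `[< forall i, u i <= v i >].

Let addA : associative add.
Proof. by move=> u v w; apply: functional_extensionality_dep => i; exact: addrA. Qed.
Let addC : commutative add.
Proof. by move=> u v; apply: functional_extensionality_dep => i; exact: addrC. Qed.
Let add0 : left_id ((fun=> 0) : P) add.
Proof. by move=> u; apply: functional_extensionality_dep => i; exact: add0r. Qed.
Let addN : left_inverse ((fun=> 0) : P) opp add.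
Proof. by move=> u; apply: functional_extensionality_dep => i; exact: addNr. Qed.
HB.instance Definition _ := GRing.isZmodule.Build P addA addC add0 addN.

Let scaleA a b u : scale a (scale b u) = scale (a * b) u.
Proof. by apply: functional_extensionality_dep => i; exact: scalerA. Qed.
Let scale1 : left_id 1 scale.
Proof. by move=> u; apply: functional_extensionality_dep => i; exact: scale1r. Qed.
Let scaleDr : right_distributive scale +%R.
Proof. by move=> a u v; apply: functional_extensionality_dep => i; exact: scalerDr. Qed.
Let scaleDl u : {morph scale^~ u : a b / a + b}.
Proof. by move=> a b; apply: functional_extensionality_dep => i; exact: scalerDl. Qed.
HB.instance Definition _ :=
  GRing.Zmodule_isLmodule.Build R P scaleA scale1 scaleDr scaleDl.

Let le_refl : reflexive le. Proof. by move=> u; apply/asboolP. Qed.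
Let le_anti : antisymmetric le.
Proof.
move=> u v /andP[/asboolP uv /asboolP vu].
by apply: functional_extensionality_dep => i; apply/le_anti; rewrite uv vu.
Qed.
Let le_trans : transitive le.
Proof.
move=> v u w /asboolP uv /asboolP vw; apply/asboolP => i.
exact: le_trans (uv i) (vw i).
Qed.
HB.instance Definition _ :=
  Order.Le_isPOrder.Build ring_display P le_refl le_anti le_trans.

Let leD2r (w u v : P) : u <= v -> u + w <= v + w.
Proof. by move=> /asboolP uv; apply/asboolP => i; exact: (vl_leD2r (w i) _ _ (uv i)). Qed.
Let scale_ge0 a u : 0 <= a -> 0 <= u -> 0 <= a *: u.
Proof.
by move=> a0 /asboolP u0; apply/asboolP => i; exact: (vl_scale_ge0 _ _ a0 (u0 i)).
Qed.
Let lexI u v w : (u <= meet v w) = (u <= v) && (u <= w).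
Proof.
apply/asboolP/andP => [h|[/asboolP uv /asboolP uw] i]; last first.
  by rewrite vl_lexI uv uw.
by split; apply/asboolP => i; have := h i; rewrite vl_lexI => /andP[].
Qed.
Let leUx u v w : (join u v <= w) = (u <= w) && (v <= w).
Proof.
apply/asboolP/andP => [h|[/asboolP uw /asboolP vw] i]; last first.
  by rewrite vl_leUx uw vw.
by split; apply/asboolP => i; have := h i; rewrite vl_leUx => /andP[].
Qed.
HB.instance Definition _ := isVectorLattice.Build R P leD2r scale_ge0 lexI leUx.
End ProductVectorLattice.

Definition directed d (I : preorderType d) : Prop :=
  inhabited I /\ forall a b : I, exists c : I, (a <= c)%O && (b <= c)%O.

(* [isys_map S ab] is the connecting map from [S b] to [S a]; the maps for    *)
(* [a = b] are not required to be identities.                                 *)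
Record inverse_system (R : realType) d (I : preorderType d) := InverseSystem {
  isys_obj :> I -> vectorLatticeType R;
  isys_map : forall a b : I, (a <= b)%O -> isys_obj b -> isys_obj a;
  isys_directed : directed I;
  isys_hom : forall (a b : I) (ab : (a <= b)%O), lattice_hom (isys_map ab);
  isys_comp : forall (a b c : I)
      (ab : (a <= b)%O) (bc : (b <= c)%O) (ac : (a <= c)%O),
    isys_map ab \o isys_map bc = isys_map ac
}.

Definition compatible_system (R : realType) d (I : preorderType d)
    (S : inverse_system R I) (E : vectorLatticeType R)
    (p : forall a, E -> S a) : Prop :=
  (forall a, lattice_hom (p a)) /\
  (forall (a b : I) (ab : (a <= b)%O), isys_map ab \o p b = p a).

Arguments compatible_system {R d I} S {E} p.

Definition is_inverse_limit (R : realType) d (I : preorderType d)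
    (S : inverse_system R I) (E : vectorLatticeType R)
    (p : forall a, E -> S a) : Prop :=
  compatible_system S p /\
  forall (E' : vectorLatticeType R) (p' : forall a, E' -> S a),
    compatible_system S p' ->
    exists! s : E' -> E, lattice_hom s /\ forall a, p a \o s = p' a.

Arguments is_inverse_limit {R d I} S {E} p.

Definition invlim_pred (R : realType) d (I : preorderType d)
    (S : inverse_system R I) : {pred vl_prod S} :=
  fun u => `[< forall (a b : I) (ab : (a <= b)%O),
                 proj a u = isys_map ab (proj b u) >].
Arguments invlim_pred {R d I} S.

(* Main.v *)
Require Import Defs.
From mathcomp Require Import all_boot all_order all_algebra.
From mathcomp Require Import mathcomp_extra boolp reals.

Import GRing.Theory.

(** E is cut out of the product by equations between lattice homomorphisms, so it is closed under
    the coordinatewise operations. A compatible system [p'] factors through the tuple map sending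
    [x] to the family of all [p' a x], which lands in E by compatibility. Points of E are determined
    by their coordinates, which makes this map a homomorphism and the only factorization. *)

Lemma invlim_predP (R : realType) (d : Order.disp_t) (I : preorderType d)
    (S : inverse_system R I) (u : vl_prod S) :
  reflect (forall (a b : I) (ab : (a <= b)%O), u a = isys_map ab (u b))
          (u \in invlim_pred S).
Proof. exact: asboolP. Qed.

Lemma invlim_vector_sublattice (R : realType) (d : Order.disp_t)
    (I : preorderType d) (S : inverse_system R I) :
  vector_sublattice (invlim_pred S).
Proof.
split.
- split=> [|k u v /invlim_predP uS /invlim_predP vS];
    apply/invlim_predP => a b ab; have [lin _ _] := isys_hom S ab.
    (* Scalar -1 turns linearity at zero into [f 0 = - f 0 + f 0 = 0]. *)
    have := lin (-1)%R 0%R 0%R; rewrite !scaleN1r !addNr => f0.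
    exact/esym/f0.
  transitivity (k *: u a + v a)%R; first by [].
  by rewrite (uS _ _ ab) (vS _ _ ab) -lin.
- move=> u v /invlim_predP uS /invlim_predP vS; apply/invlim_predP => a b ab.
  have [_ meetf _] := isys_hom S ab.
  transitivity (vl_meet (u a) (v a)); first by [].
  by rewrite (uS _ _ ab) (vS _ _ ab) -meetf.
- move=> u v /invlim_predP uS /invlim_predP vS; apply/invlim_predP => a b ab.
  have [_ _ joinf] := isys_hom S ab.
  transitivity (vl_join (u a) (v a)); first by [].
  by rewrite (uS _ _ ab) (vS _ _ ab) -joinf.
Qed.

(** The operations of E reduce to coordinatewise ones, so the projections are homomorphisms by
    conversion; compatibility is membership in E, read backwards. *)
Lemma invlim_compatible (R : realType) (d : Order.disp_t) (I : preorderType d)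
    (S : inverse_system R I) (ES : vector_sublattice (invlim_pred S)) :
  compatible_system S (fun (a : I) (u : sub_vlattice ES) => proj a (\val u)).
Proof.
split=> [a|a b ab]; first by split.
by apply/funext => u; have /invlim_predP/(_ a b ab) := valP u.
Qed.

(* Part (i) is the proposition over which the existential quantifier ranges:
   the set E has to satisfy it to be an object of the category in part (ii). *)
Theorem theorem4p4 (R : realType) (d : Order.disp_t) (I : preorderType d)
    (S : inverse_system R I) :
  exists ES : vector_sublattice (invlim_pred S),
    is_inverse_limit S
      (fun (a : I) (u : sub_vlattice ES) => proj a (\val u)).
Proof.
pose ES := invlim_vector_sublattice _ _ _ S.
exists ES; split=> [|E' p' [p'_hom p'_comp]]; first exact: invlim_compatible.
have p'S x : ((fun a => p' a x) : vl_prod S) \in invlim_pred S.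
  by apply/invlim_predP => a b ab; rewrite -(p'_comp a b ab).
pose s x : sub_vlattice ES := exist (fun u => u \in invlim_pred S) _ (p'S x).
exists s; split=> [|t [_ tp]].
  split=> //; split=> [k x y|x y|x y]; apply/val_inj/functional_extensionality_dep => a;
    have [lin meetf joinf] := p'_hom a.
  - exact: lin.
  - exact: meetf.
  - exact: joinf.
(* Uniqueness: [tp] prescribes every coordinate of [t x]. *)
apply/funext => x; apply/val_inj/functional_extensionality_dep => a.
exact/esym/(congr1 (@^~ x) (tp a)).
Qed.
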